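(* Let $u \neq 0$ (i.e. $u$ not identically zero) be a solution of the Airy equation $u''(z) = z\,u(z)$ in the complex domain, and let $U$ be a function satisfying $U' = u$. Then the functions $u, u', U$ are algebraically independent over the field $\mathbb{C}(z)$ of rational functions.
   Context: Solutions of the Airy equation $u'' = zu$ are considered in the complex domain; they are entire functions $u:\mathbb{C}\to\mathbb{C}$, and their antiderivatives $U$ are entire as well. $\mathbb{C}(z)$ is the field of rational functions in the complex variable $z$, regarded together with the entire functions as a subset of the field of meromorphic functions on $\mathbb{C}$; algebraic independence is understood there. *)

(* Defs.v *)
(* MathComp / MathComp-Analysis; the complex field is R[i] for R : realType. *)
From HB Require Import structures.
From mathcomp Require Import all_boot all_order all_algebra.
From mathcomp Require Import all_classical all_reals all_analysis.
From mathcomp Require Import complex.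
(* The notations of mpoly clash with those of MathComp-Analysis. *)
From mathcomp Require Import -(notations) mpoly.

Set Implicit Arguments.
Unset Strict Implicit.
Unset Printing Implicit Defensive.
Import Order.TTheory GRing.Theory Num.Theory.
Import numFieldNormedType.Exports.
Local Open Scope ring_scope.
Local Open Scope classical_set_scope.

(* Functions are typed on R[i]^o, the alias of R[i] that carries the topology
   and the structure of normed module over R[i]; hence derivable _ _ 1 and
   _^`() are complex differentiability and the complex derivative. *)

Section Airy.
Variable R : realType.
Implicit Types u U : R[i]^o -> R[i]^o.

Definition airy_solution u : Prop :=
  [/\ forall z : R[i]^o, derivable u z 1,
      forall z : R[i]^o, derivable u^`() z 1
    & forall z : R[i]^o, u^`(2) z = z * u z].

Definition antiderivative u U : Prop := forall z : R[i]^o, is_derive z 1 U (u z).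

End Airy.

Section AlgebraicIndependence.
Variable R : realType.

Local Notation ratfun := {fraction {poly R[i]}}.
Local Notation "x %:F" := (@FracField.tofrac _ x).

(* The value at z of the rational function r, with the default value 0 when z is
   a pole of r. *)
Definition ratfun_eval (r : ratfun) (z : R[i]^o) : R[i]^o :=
  xget 0 [set c : R[i]^o | exists p q : {poly R[i]},
    [/\ q.[z] != 0, r = p%:F / q%:F & c = p.[z] / q.[z]]].

Lemma ratfun_evalE (p q : {poly R[i]}) (z : R[i]) :
  q.[z] != 0 -> ratfun_eval (p%:F / q%:F) z = p.[z] / q.[z].
Proof.
move=> qz; rewrite /ratfun_eval; case: xgetP => [c _ [p' [q' [q'z e ->]]]|]; last first.
  by move/(_ (p.[z] / q.[z])); case; exists p, q.
have nz (s : {poly R[i]}) : s.[z] != 0 -> s%:F != 0 :> ratfun.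
  by apply: contraNneq => /eqP; rewrite tofrac_eq0 => /eqP ->; rewrite horner0.
move/eqP: e; rewrite eqr_div ?nz// -!tofracM tofrac_eq => /eqP e.
by apply/eqP; rewrite eqr_div// -!hornerM e.
Qed.

(* Equality of meromorphic functions on the complex plane represented by
   everywhere defined ones: agreement off a closed discrete set, that is, off a
   set without limit points; in particular the values at poles are ignored. *)
Definition mero_eq (f g : R[i]^o -> R[i]^o) : Prop :=
  exists2 D : set R[i]^o, limit_point D = set0 & forall z, ~ D z -> f z = g z.

Definition alg_independent n (f : n.-tuple (R[i]^o -> R[i]^o)) : Prop :=
  forall P : mpoly.mpoly n ratfun,
    mero_eq (fun z => mpoly.mmap (ratfun_eval^~ z) (fun j => tnth f j z) P)
            (fun=> 0) ->
    P = 0.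

End AlgebraicIndependence.

(* Main.v *)
Require Import Defs.
From HB Require Import structures.
From mathcomp Require Import all_boot all_order all_algebra.
From mathcomp Require Import all_classical all_reals all_analysis.
From mathcomp Require Import complex.
From mathcomp Require Import -(notations) mpoly.
From mathcomp Require Import ring lra zify.
Set Implicit Arguments.
Unset Strict Implicit.
Unset Printing Implicit Defensive.
Import Order.TTheory GRing.Theory Num.Theory.
Import numFieldNormedType.Exports.
Local Open Scope ring_scope.

(* On the open set where u != 0 use the coordinates z, t = u'/u, l = u, w = U.
   They satisfy z' = 1, t' = z - t^2, l' = t l, w' = l, so the polynomials in
   z, t, l, w that vanish there form an ideal I of C[z][t][l][w] that is stable
   under a polynomial derivation, and one shows I = 0 one variable at a time.

   - An element of I of minimal degree d in t, with leading coefficient in C[z]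
     of minimal degree, satisfies p' + d t p = b p with b in C[z]; that is, the
     form u^d p(z, u'/u) is semi-invariant of degree d in u, u'. This forces
     d = 0: give z weight 2 and t weight 1 and consider the part a of p of
     highest weight. It is killed by the operator T of Sym^d induced by the
     derivation exchanging u and u', which is self-adjoint for a positive
     Hermitian form; pairing the next equations with a shows that b = 0 and that
     the coefficients of a are free of z, so a is a single monomial killed by T
     and d = 0.
   - A relation of minimal degree n in l gives two nonzero elements p, q of
     C[z][t] for which u^n p / q is constant, and a relation of minimal degree
     in w gives either the same or p, q for which u p / q is an antiderivative
     of k u, where k != 0 is constant. When p and q are coprime, q divides its
     derivative, hence q is in C[z] by the first step, and comparing degrees in
     t leaves either a semi-invariant p or a rational solution y of
     y'' = z y - k; neither exists. *)

(** * Symmetric powers and a positive Hermitian form *)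

Section SymmetricPower.
Variables (C : numClosedFieldType) (d : nat).
Implicit Types x y : nat -> C.

(* The action, on the coefficients of [\sum_i x_i X^(d-i) Y^i], of the derivation
   that exchanges [X] and [Y]. *)
Definition sym_step x i : C :=
  i.+1%:R * x i.+1 + (if i is j.+1 then (d%:R - j%:R) * x j else 0).

Let up x i : C := i.+1%:R * x i.+1.
Let down x i : C := if i is j.+1 then (d%:R - j%:R) * x j else 0.

Let bilin x y : C := \sum_(i < d.+1) x i * y i / 'C(d, i)%:R.

(** With the weights 1 / C(d, i), adjointness of the two shifts is the identity (i+1) C(d, i+1) =
    (d-i) C(d, i). *)
Let up_adjoint x y : x d.+1 = 0 -> bilin (up x) y = bilin x (down y).
Proof.
move=> xd0; rewrite /bilin big_ord_recr big_ord_recl /= /up /down xd0.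
rewrite !(mulr0, mul0r) addr0 add0r; apply: eq_bigr => -[i ilt] _ /=.
rewrite /bump /= !add1n.
have nz k : (k <= d)%N -> 'C(d, k)%:R != 0 :> C.
  by move=> kd; rewrite pnatr_eq0 -lt0n bin_gt0.
have e : i.+1%:R * 'C(d, i.+1)%:R = (d%:R - i%:R) * 'C(d, i)%:R :> C.
  by rewrite -natrB 1?ltnW// -!natrM mul_bin_left.
have := nz _ ilt; have := nz _ (ltnW ilt).
move: e; set a := 'C(d, i)%:R; set b := 'C(d, i.+1)%:R => e a0 b0.
apply/eqP; rewrite eqr_div//; apply/eqP.
rewrite -[LHS]/(i.+1%:R * x i.+1 * y i * b).
have -> : i.+1%:R * x i.+1 * y i * b = x i.+1 * y i * (i.+1%:R * b) by ring.
by rewrite e; ring.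
Qed.

(* [sym_step] is self-adjoint for the positive Hermitian form with weights
   [1 / 'C(d, i)]. *)
Let sym_step_adjoint x y : x d.+1 = 0 -> y d.+1 = 0 ->
  bilin (sym_step x) y = bilin x (sym_step y).
Proof.
move=> xd yd.
have bC f g : bilin f g = bilin g f.
  by apply: eq_bigr => i _; rewrite (mulrC (f i)).
have bD f g h : bilin (fun i => f i + g i) h = bilin f h + bilin g h.
  by rewrite -big_split; apply: eq_bigr => i _ /=; rewrite !mulrDl.
by rewrite [LHS]bD [RHS]bC [RHS]bD up_adjoint// -bC [in RHS]up_adjoint// bC addrC bC.
Qed.

(** Write T for [sym_step d] and pair T y with the conjugate of x. Since T is self-adjoint and T x =
    0, the sum of the [e i] |x_i|^2 / C(d, i) vanishes, and its terms are nonnegative. *)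
Lemma sym_step_kernel x y (e : nat -> nat) (c : C) :
    (forall i, (d < i)%N -> x i = 0) -> (forall i, (d < i)%N -> y i = 0) ->
    (forall i, (i <= d)%N -> sym_step x i = 0) ->
    (forall i, (i <= d)%N -> sym_step y i = c * (e i)%:R * x i) ->
  c != 0 -> forall i, (i <= d)%N -> (e i)%:R * x i = 0.
Proof.
move=> x0 y0 Tx Ty c0.
have : bilin (sym_step y) (fun i => (x i)^*) = 0.
  rewrite sym_step_adjoint ?y0 ?x0 ?conjC0// /bilin big1// => i _.
  have -> : sym_step (fun i => (x i)^*) i = (sym_step x i)^*.
    rewrite /sym_step rmorphD rmorphM rmorph_nat; case: (nat_of_ord i) => [|j].
      by rewrite rmorph0.
    by rewrite rmorphM rmorphB !rmorph_nat.
  by rewrite Tx -1?ltnS// conjC0 mulr0 mul0r.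
have -> : bilin (sym_step y) (fun i => (x i)^*) =
          c * \sum_(i < d.+1) (e i)%:R * (x i * (x i)^*) / 'C(d, i)%:R.
  rewrite /bilin mulr_sumr; apply: eq_bigr => i _; rewrite Ty -1?ltnS//.
  by rewrite !mulrA.
move/eqP; rewrite mulf_eq0 (negPf c0) /= => S0 i id.
have pos j : 0 <= (e j)%:R * (x j * (x j)^*) / 'C(d, j)%:R.
  by rewrite divr_ge0 ?ler0n// mulr_ge0 ?ler0n// mul_conjC_ge0.
move: S0; rewrite psumr_eq0// => /allP/(_ (inord i)); rewrite mem_index_enum.
move/(_ isT); rewrite /= inordK ?ltnS// mulf_eq0 invr_eq0 pnatr_eq0.
rewrite -[X in _ || X]negbK -lt0n bin_gt0 id orbF mulf_eq0 mul_conjC_eq0.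
by rewrite -mulf_eq0 => /eqP.
Qed.

End SymmetricPower.

(** * Extension of derivations to polynomials *)

Section Derivations.

(** When [d] is a derivation, this is its extension to [{poly A}] with ['X] sent to [g]. *)
Definition extend_der (A : comNzRingType) (d : A -> A) (g p : {poly A}) : {poly A} :=
  map_poly d p + g * p^`().

Lemma coef_extend_derC (A : comNzRingType) (d : A -> A) (g : A) p i : d 0 = 0 ->
  (extend_der d g%:P p)`_i = d p`_i + g * (p`_i.+1 *+ i.+1).
Proof. by move=> d0; rewrite coefD coef_map_id0// coefCM coef_deriv. Qed.

Lemma coef_extend_derX (A : comNzRingType) (d : A -> A) (g : A) p i : d 0 = 0 ->
  (extend_der d (g *: 'X) p)`_i = d p`_i + g * (p`_i *+ i).
Proof.
move=> d0; rewrite coefD coef_map_id0// -scalerAl coefZ coefXM coef_deriv.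
by case: i.
Qed.

End Derivations.

(** * Semi-invariants and ratios over C[z][t] *)

Section Forms.
Variable C : numClosedFieldType.
Implicit Types (a b c : {poly C}) (p q : {poly {poly C}}).

(** The inner variable is z, the outer one t; t = u'/u satisfies the Riccati equation t' = z -
    t^2. *)
Definition dt p := extend_der (@deriv C) ('X%:P - 'X^2) p.

Lemma coef_dt p i : (dt p)`_i = (p`_i)^`() + i.+1%:R * 'X * p`_i.+1
  - (if i is j.+1 then j%:R * p`_j else 0).
Proof.
rewrite /dt /extend_der coefD coef_map_id0 ?deriv0// mulrBl coefB coefCM.
rewrite coefXnM !coef_deriv addrA -[X in 'X * X]mulr_natl mulrA (mulrC 'X).
congr (_ - _); case: i => [|[|i]]//=; first by rewrite mul0r.
by rewrite !subSS subn0 mulr_natl.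
Qed.

Lemma dtM p q : dt (p * q) = dt p * q + p * dt q.
Proof.
suff e : map_poly (@deriv C) (p * q) =
    map_poly (@deriv C) p * q + p * map_poly (@deriv C) q.
  by rewrite /dt /extend_der derivM e; ring.
apply/polyP => i; rewrite coef_map coefD !coefM /= raddf_sum -big_split /=.
by apply: eq_bigr => j _; rewrite derivM !coef_map.
Qed.

Lemma dtC a : dt a%:P = a^`()%:P.
Proof. by rewrite /dt /extend_der derivC mulr0 addr0 map_polyC. Qed.

Lemma size_dt p : (size (dt p) <= (size p).+1)%N.
Proof.
apply/leq_sizeP => -[//|j] jp; rewrite coef_dt !nth_default ?deriv0 ?mulr0 ?subr0 ?addr0//.
  by apply: ltnW; apply: ltnW.
by apply: ltnW.
Qed.

Section NoSemiInvariants.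
Variables (d : nat) (p : {poly {poly C}}) (b : {poly C}).
Hypotheses (sp : (size p <= d.+1)%N) (p0 : p != 0).
Hypothesis Dp : dt p + d%:R * 'X * p = b%:P * p.

(* The weighted homogeneous parts of [p], for the weights 2 of [z] and 1 of
   [t], become visible as coefficients after the substitution [z = s ^ 2]. *)
Let hat i : {poly C} := (p`_i \Po 'X^2) * 'X^i.

(** This is coefficient i of [Dp] after z = s^2, multiplied by 2 s^(i+2); the operator s d/ds - i
    extracts the z-derivative of the coefficient. *)
Let hatE i : 'X * (hat i)^`() - i%:R * hat i +
    'X^3 * (2%:R * (i.+1%:R * hat i.+1 +
                 (if i is j.+1 then (d%:R - j%:R) * hat j else 0))) =
  'X^2 * (2%:R * ((b \Po 'X^2) * hat i)).
Proof.
have := congr1 (fun r : {poly {poly C}} => r`_i \Po 'X^2) Dp.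
rewrite coefD coefCM coef_dt -(mulrA _ 'X p) -(polyC_natr {poly C} d) coefCM coefXM.
rewrite /hat derivM deriv_comp !derivXn.
case: i => [|i] /=.
  rewrite !mulr0 subr0 addr0 !comp_polyD !comp_polyM comp_polyX.
  rewrite -polyC_natr comp_polyC polyC_natr => e; rewrite [(b \Po _) * (_ * _)]mulrA -e.
  have ring0 (A : comNzRingType) (x u v w : A) :
      x * (u * (x *+ 2) * 1 + v *+ 0) - 0 * (w * 1) +
      x ^+ 3 * (2 * (1 * (v * x) + 0)) = x ^+ 2 * (2 * ((u + 1 * x ^+ 2 * v) * 1)).
    by ring.
  exact: ring0.
rewrite !comp_polyD raddfN /= !comp_polyM comp_polyX -!polyC_natr !comp_polyC => e.
rewrite [(b \Po _) * (_ * _)]mulrA -e.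
have ringS (A : comNzRingType) (x u v w y s : A) :
   x * (u * (x *+ 2) * (x * s) + w * (s *+ i.+1)) - i.+1%:R * (w * (x * s)) +
   x ^+ 3 * (2 * (i.+2%:R * (v * (x * (x * s))) + (d%:R - i%:R) * (y * s))) =
   x ^+ 2 * (2 * ((u + i.+2%:R * x ^+ 2 * v - i%:R * y + d%:R * y) * (x * s))).
  by rewrite -mulr_natl; ring.
rewrite !polyC_natr (exprS 'X i.+1) (exprS 'X i).
exact: ringS.
Qed.

Let F n i : C := (hat i)`_n.

(** [F n] is the part of weight n. Differentiation in z lowers the weight by 2 and [sym_step d]
    raises it by 1, hence the shift by 3. *)
Let coefFE n i : (n%:R - i%:R) * F n i +
    (if (n < 3)%N then 0 else 2%:R * sym_step d (F (n - 3)) i) =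
  if (n < 2)%N then 0 else 2%:R * ((b \Po 'X^2) * hat i)`_(n - 2).
Proof.
have := congr1 (fun r : {poly C} => r`_n) (hatE i).
rewrite !coefD coefN !coefXnM coefXM coef_deriv -!polyC_natr !coefCM coefD coefCM.
move=> <-; rewrite mulrBl -!addrA; congr (_ + _).
  by case: n => [|n]; rewrite ?mul0r// mulr_natl.
congr (_ + _); case: ifP => // _; congr (_ * (_ + _)).
by case: i => [|i]; rewrite ?coef0// -polyC_natr -polyCB coefCM.
Qed.

Lemma semi_invariant_degree : d = 0%N.
Proof.
have hat0 i : (d < i)%N -> hat i = 0.
  by move=> di; rewrite /hat nth_default ?comp_poly0 ?mul0r// (leq_trans sp).
pose M := (\max_(i < d.+1) size (hat i))%N.
have szhat i : (size (hat i) <= M)%N.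
  have [id|/hat0->] := leqP i d; last by rewrite size_poly0.
  exact: (leq_bigmax (Ordinal (id : i < d.+1)%N)).
have [i1 Mi1] : {i1 : 'I_d.+1 | M = size (hat i1)}.
  by apply: bigop.eq_bigmax; rewrite card_ord.
have M0 : (0 < M)%N.
  have [i pi0] : exists i, p`_i != 0 by exists (size p).-1; rewrite lead_coef_eq0.
  apply: leq_trans (szhat i); rewrite lt0n size_poly_eq0 mulf_neq0//.
    by rewrite comp_poly_eq0 ?size_polyXn.
  by rewrite -size_poly_eq0 size_polyXn.
(* The highest weight in [p]; [F m] is the corresponding part. *)
pose m := M.-1; have Mm : M = m.+1 by rewrite prednK.
have Fgt n i : (m < n)%N -> F n i = 0.
  by move=> mn; rewrite /F nth_default// (leq_trans (szhat i))// Mm.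
have Fi1 : F m i1 != 0 by rewrite /F /m Mi1 lead_coef_eq0 -size_poly_eq0 -Mi1 Mm.
have Fd n i : (d < i)%N -> F n i = 0 by move/hat0; rewrite /F => ->; rewrite coef0.
have stepgt n i : (m < n)%N -> sym_step d (F n) i = 0.
  move=> mn; rewrite /sym_step Fgt// mulr0 add0r.
  by case: (i) => // j; rewrite Fgt// mulr0.
have two0 : 2%:R != 0 :> C by rewrite pnatr_eq0.
(* A nonconstant [b] would raise the highest weight by at least 2, the left side only by 1. *)
have szb : (size b <= 1)%N.
  rewrite leqNgt; apply/negP => b1.
  have e2 : (2 <= (size (b \Po 'X^2)).-1)%N.
    by rewrite size_comp_poly size_polyXn muln2 (leq_double 1) -ltnS prednK // ltnW.
  have e0 : b \Po 'X^2 != 0 by rewrite -size_poly_eq0; lia.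
  have hi0 : hat i1 != 0 by rewrite -size_poly_eq0 -Mi1 Mm.
  move: (coefFE (m + (size (b \Po 'X^2)).-1 + 2) i1).
  rewrite Fgt ?stepgt; [|lia..].
  rewrite !ifF; [|lia..].
  rewrite !mulr0 addr0 addnK => /esym/eqP; rewrite mulf_eq0 (negPf two0) /=.
  have -> : (m + (size (b \Po 'X^2)).-1)%N = (size ((b \Po 'X^2) * hat i1)).-1.
    rewrite size_mul// -Mi1 Mm addnS /= addnC.
    by move: e2; case: (size _).
  by rewrite lead_coef_eq0 mulf_eq0 (negPf e0) (negPf hi0).
have [beta bE] : exists beta, b = beta%:P by exists b`_0; exact: size1_polyC.
have coefb n i : ((b \Po 'X^2) * hat i)`_n = beta * F n i.
  by rewrite bE comp_polyC coefCM.
(* In the coefficient of s^(m+3) only T (F m) survives. *)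
have step0 i : (i <= d)%N -> sym_step d (F m) i = 0.
  move=> id; move: (coefFE (m + 3) i); rewrite Fgt; last lia.
  rewrite !ifF; [|lia..].
  rewrite addnK mulr0 add0r coefb Fgt; last lia.
  by rewrite !mulr0 => /eqP; rewrite mulf_eq0 (negPf two0) /= => /eqP.
(* The coefficient of s^(m+2) reads T (F (m-1)) = beta F m; for m = 0 the part of weight m-1 is
   0. *)
have beta0 : beta = 0.
  apply/eqP/negPn/negP => beta0; apply/negP: Fi1; rewrite negbK.
  pose y i := if (0 < m)%N then F m.-1 i else 0.
  have := @sym_step_kernel C d (F m) y (fun=> 1%N) beta.
  move=> /(_ (Fd m)) h; apply/eqP; rewrite -[F _ _]mul1r; apply: h => //.
  - by rewrite /y => i di; case: ifP => // _; exact: Fd.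
  - move=> i id; rewrite mulr1; move: (coefFE (m + 2) i).
    rewrite Fgt; last lia.
    rewrite mulr0 add0r addnK coefb [in RHS]ifF; last lia.
    rewrite /y; have [m0|m0] := posnP m.
      rewrite ifT; last lia.
      move=> /esym/eqP; rewrite mulf_eq0 (negPf two0) /= => /eqP ->.
      by rewrite /sym_step !mulr0 add0r; case: (i) => // j; rewrite mulr0.
    rewrite ifF; last lia.
    by have -> : (m + 2 - 3 = m.-1)%N; [lia | move/(mulfI two0)].
  - by rewrite -ltnS.
(* The coefficient of s^m writes (m-i) F m i as a multiple of T (F (m-3)), so [sym_step_kernel]
   applies again. Only a constant times t^m is left in the top part. *)
have only_m i : (i <= d)%N -> i != m -> F m i = 0.
  move=> id im.
  have Flt j : (m < j)%N -> F m j = 0.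
    by move=> mj; rewrite /F /hat coefMXn mj.
  have [mi|im'|im'] := ltngtP m i; [exact: Flt| |by rewrite im' eqxx in im].
  pose y i := if (2 < m)%N then F (m - 3)%N i else 0.
  have := @sym_step_kernel C d (F m) y (fun i => (m - i)%N) (- 2^-1).
  move=> /(_ (Fd m)) h; suff /eqP : (m - i)%N%:R * F m i = 0.
    by rewrite mulf_eq0 pnatr_eq0 subn_eq0 leqNgt im' => /eqP.
  have half0 : - 2^-1 != 0 :> C by rewrite oppr_eq0 invr_eq0.
  apply: h => //.
  - by rewrite /y => j dj; case: ifP => // _; exact: Fd.
  - move=> j jd; move: (coefFE m j); rewrite !coefb beta0 !mul0r mulr0 if_same.
    have -> : (m%:R - j%:R) * F m j = (m - j)%N%:R * F m j.
      have [jm|mj] := leqP j m; first by rewrite natrB.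
      by rewrite Flt// !mulr0.
    have -> : (if (m < 3)%N then 0 else 2%:R * sym_step d (F (m - 3)) j) =
              2%:R * sym_step d y j.
      rewrite /y; case: ltnP => [m3|//].
      rewrite /sym_step !mulr0 add0r.
      by case: (j) => [|k]; rewrite ?mulr0.
    by move/eqP; rewrite addrC addr_eq0 => /eqP e; apply: (mulfI two0); rewrite e; field.
have i1d : (i1 <= d)%N by rewrite -ltnS.
have i1m : (i1 : nat) = m.
  by apply: contraNeq Fi1 => i1m; rewrite only_m.
have md : (m <= d)%N by rewrite -i1m.
have Fm : F m m != 0 by rewrite -[X in F _ X]i1m.
have Fne i : i != m -> F m i = 0.
  by have [id|/Fd//] := leqP i d; exact: only_m.
(* Row m-1 of T (F m) = 0 reads m F m m = 0. *)
have m0 : m = 0%N.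
  have [//|m0] := posnP m.
  have := step0 m.-1 (leq_trans (leq_pred _) md); rewrite /sym_step prednK//.
  have -> : (if m.-1 is j.+1 then (d%:R - j%:R) * F m j else 0) = 0.
    by case E : m.-1 => [//|j]; rewrite Fne ?mulr0//; apply/eqP; lia.
  by rewrite addr0 => /eqP; rewrite mulf_eq0 (negPf Fm) pnatr_eq0 -leqn0 leqNgt m0.
(* Row 1 now reads d F 0 0 = 0. *)
have [//|d0] := posnP d.
have := step0 1%N d0; rewrite /sym_step Fne ?m0// mulr0 add0r subr0 => /eqP.
move: Fm; rewrite m0 => /negPf Fm; rewrite mulf_eq0 Fm orbF pnatr_eq0.
by move/eqP.
Qed.

End NoSemiInvariants.

Lemma root_coefs_factor p (x : C) : (forall i, root p`_i x) ->
  exists p1, p = ('X - x%:P)%:P * p1.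
Proof.
move=> px; exists (map_poly (fun r => r %/ ('X - x%:P)) p).
apply/polyP => i; rewrite coefCM coef_map_id0 ?div0p// mulrC divpK//.
by rewrite dvdp_XsubCl.
Qed.

(** The denominator c is removed root by root. A root x of c either is a root of b and cancels, or
    is a root of every coefficient of p; then p = (z - x) p1, and p1 satisfies the equation with b -
    c / (z - x) in place of b. *)
Lemma semi_invariant_degree_frac d p b c : (size p <= d.+1)%N -> p != 0 ->
  c != 0 -> c%:P * (dt p + d%:R * 'X * p) = b%:P * p -> d = 0%N.
Proof.
have [n] := ubnP (size c + size (lead_coef p)).
elim: n p b c => // n IH p b c cpn sp p0 c0 e.
have [sc|/eqP sc] := eqVneq (size c) 1%N.
  have [k k0 cE] : exists2 k, k != 0 & c = k%:P.
    exists c`_0; last by apply: size1_polyC; rewrite sc.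
    by apply: contra_neq c0 => k0; rewrite [c]size1_polyC ?sc// k0.
  apply: (@semi_invariant_degree d p (k^-1%:P * b)) => //.
  by rewrite polyCM -(mulrA _ b%:P p) -e cE mulrA -!polyCM mulVf// mul1r.
have /closed_rootP [x cx] := introN eqP sc.
have [c1 cE] := factor_theorem _ _ cx.
have X0 : ('X - x%:P)%:P != 0 :> {poly {poly C}} by rewrite polyC_eq0 polyXsubC_eq0.
have X1 : 'X - x%:P != 0 :> {poly C} by rewrite polyXsubC_eq0.
have c10 : c1 != 0 by apply: contra_neq c0; rewrite cE => ->; rewrite mul0r.
have szc : size c = (size c1).+1 by rewrite cE size_Mmonic ?monicXsubC// size_XsubC addn2.
have [bx|bx] := boolP (root b x).
  have [b1 bE] := factor_theorem _ _ bx.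
  apply: (IH p b1 c1) => //; first by move: cpn; rewrite szc addSn ltnS.
  by apply: (mulfI X0); rewrite !mulrA -!polyCM (mulrC _ c1) (mulrC _ b1) -cE -bE.
have [i|p1 pE] := @root_coefs_factor p x.
  have := congr1 (fun r : {poly {poly C}} => root r`_i x) e.
  by rewrite !coefCM !rootM cx (negPf bx) /= => <-.
have p10 : p1 != 0 by apply: contra_neq p0; rewrite pE => ->; rewrite mulr0.
have szp : size p = size p1 by rewrite pE mul_polyC size_scale.
apply: (IH p1 (b - c1) c) => //; last first.
- apply: (mulfI X0); apply: (addIr (c1%:P * ('X - x%:P)%:P * p1)).
  move: e; rewrite pE dtM dtC derivXsubC [in X in X * (_ + _)]cE => e.
  rewrite mulrA -mulrA.
  transitivity (b%:P * (('X - x%:P)%:P * p1)); last by rewrite polyCB; ring.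
  by rewrite -e [in LHS]cE !polyCM; ring.
- by rewrite -szp.
- move: cpn; rewrite pE lead_coefM lead_coefC size_monicM ?monicXsubC ?lead_coef_eq0//.
  by rewrite size_XsubC add2n addnS ltnS.
Qed.

(** The multiplicity of x in the derivative of c is one less than in c, so b has to supply the
    missing factor. *)
Lemma root_mul_deriv b c (x : C) : c != 0 -> root c x -> c %| b * c^`() -> root b x.
Proof.
move=> c0 cx; have [k [c1 /implyP/(_ c0) c1x cE]] := multiplicity_XsubC c x.
have Y0 : 'X - x%:P != 0 :> {poly C} by rewrite polyXsubC_eq0.
case: k cE => [|k] cE; first by rewrite cE expr0 mulr1 (negPf c1x) in cx.
move=> /dvdpP[s]; rewrite cE derivM deriv_exp derivXsubC /= mul1r -mulr_natl => e.
have : b * (c1^`() * ('X - x%:P) + k.+1%:R * c1) = s * (c1 * ('X - x%:P)).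
  by apply: (mulIf (expf_neq0 k Y0)); apply: etrans (etrans e _);
    rewrite exprS; ring.
move=> /(congr1 (fun r : {poly C} => r.[x])).
rewrite !hornerE subrr !mulr0 add0r -polyC_natr hornerC.
by rewrite /= mulr0 => /eqP; rewrite !mulf_eq0 pnatr_eq0 -!rootE (negPf c1x) !orbF.
Qed.

(* Clearing denominators, this says that [y'' = z y - k] has no rational
   solution [y] for a constant [k != 0]: take [y = p1 / q], [- y' = p0 / q]. *)
Lemma airy_no_rational (k : C) (p0 p1 q : {poly C}) : q != 0 -> k != 0 ->
  q * (p0^`() + 'X * p1) - p0 * q^`() = k%:P * q ^+ 2 ->
  q * (p1^`() + p0) - p1 * q^`() = 0 -> False.
Proof.
have [n] := ubnP (size q); elim: n p0 p1 q => // n IH p0 p1 q qn q0 k0 e0 e1.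
(* For constant q the equations give z p1 = k q + p1'', whose left side has too large a degree
   unless p1 = 0, and then k q = 0. *)
have [sq|/eqP sq] := eqVneq (size q) 1%N.
  have /size1_polyC qE : (size q <= 1)%N by rewrite sq.
  have p0E : p0 = - p1^`().
    move: e1; rewrite [in q^`()]qE derivC mulr0 subr0 => /eqP.
    by rewrite mulf_eq0 (negPf q0) addrC addr_eq0 => /eqP.
  have: 'X * p1 = k%:P * q + p1^`()^`().
    apply: (mulfI q0); move: e0; rewrite [in q^`()]qE derivC mulr0 subr0 p0E derivN.
    move=> e; transitivity (q * (- p1^`()^`() + 'X * p1) + q * p1^`()^`()); first by ring.
    by rewrite e; ring.
  have [->|p10] := eqVneq p1 0.
    rewrite mulr0 !linear0 addr0 => /esym/eqP.
    by rewrite mulf_eq0 polyC_eq0 (negPf k0) (negPf q0).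
  move=> e; have := size_polyD (k%:P * q) p1^`()^`(); rewrite -e mulrC size_mulX//.
  have le_deriv (r : {poly C}) : (size r^`() <= size r)%N.
    by have [->|/lt_size_deriv/ltnW//] := eqVneq r 0; rewrite deriv0.
  rewrite ltnNge geq_max (leq_trans (le_deriv _) (le_deriv _)) andbT.
  by rewrite mul_polyC size_scale// sq lt0n size_poly_eq0 p10.
(* Modulo q the equations say that q divides p0 q' and p1 q', so a root of q is common to all three
   and can be cancelled. *)
have /closed_rootP [x qx] := introN eqP sq.
have p0x : root p0 x.
  apply: (root_mul_deriv q0 qx); apply/dvdpP.
  exists (p0^`() + 'X * p1 - k%:P * q).
  by transitivity (q * (p0^`() + 'X * p1) - k%:P * q ^+ 2); [rewrite -e0|]; ring.
have p1x : root p1 x.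
  apply: (root_mul_deriv q0 qx); apply/dvdpP; exists (p1^`() + p0).
  by rewrite [RHS]mulrC; apply/esym/(subr0_eq e1).
have [r0 p0E] := factor_theorem _ _ p0x.
have [r1 p1E] := factor_theorem _ _ p1x.
have [r qE] := factor_theorem _ _ qx.
have X0 : 'X - x%:P != 0 :> {poly C} by rewrite polyXsubC_eq0.
have r_0 : r != 0 by apply: contra_neq q0; rewrite qE => ->; rewrite mul0r.
apply: (IH r0 r1 r) => //.
- by move: qn; rewrite qE size_Mmonic ?monicXsubC// size_XsubC addn2.
- apply: (mulfI X0); apply: (mulfI X0); move: e0.
  rewrite p0E p1E qE !derivM derivXsubC => e0.
  transitivity (k%:P * (r * ('X - x%:P)) ^+ 2); last by ring.
  by rewrite -e0; ring.
- apply: (mulfI X0); apply: (mulfI X0); move: e1.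
  by rewrite p0E p1E qE !derivM derivXsubC !mulr0 => <-; ring.
Qed.

Lemma coef_dt_top d p : (size p <= d.+1)%N ->
  (dt p)`_d.+1 = - (d%:R * p`_d).
Proof.
move=> sp; rewrite coef_dt [p`_d.+1]nth_default// [p`_d.+2]nth_default 1?ltnW//.
by rewrite deriv0 mulr0 addr0 sub0r.
Qed.

(** The terms of degree d+1 in t cancel: differentiating a form of degree d in u, u' gives such a
    form again. *)
Lemma size_dt_weight d p : (size p <= d.+1)%N ->
  (size (dt p + d%:R * 'X * p)%R <= d.+1)%N.
Proof.
move=> sp; apply/leq_sizeP => j; rewrite leq_eqVlt => /predU1P[<-|dj].
  rewrite coefD coef_dt_top// -mulrA -polyC_natr coefCM coefXM /=.
  by rewrite addNr.
rewrite nth_default// (leq_trans (size_polyD _ _))// geq_max.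
rewrite (leq_trans (size_dt _)) ?(leq_ltn_trans sp)//= -mulrA -polyC_natr mul_polyC.
rewrite (leq_trans (size_scale_leq _ _))// mulrC.
have [->|p0] := eqVneq p 0; first by rewrite mul0r size_poly0.
by rewrite size_mulX// (leq_ltn_trans sp).
Qed.

(* The hypothesis says that [f = l ^ e * (p / q)] satisfies [f' = k * l]. *)
Lemma airy_ratio_coprime e (k : C) p q : (0 < e)%N -> p != 0 -> q != 0 ->
  k = 0 \/ e = 1%N -> coprimep p q ->
  q * dt p - p * dt q + e%:R * 'X * p * q = k%:P%:P * q ^+ 2 -> False.
Proof.
move=> e0 p0 q0 ke pq E.
(* The equation modulo q shows that q divides [p * dt q]. Divisibility is over the fractions of
   C[z], hence the factor [s] below. *)
have : q %| dt q.
  rewrite -(@Gauss_dvdpr _ _ p) 1?coprimep_sym//.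
  suff -> : p * dt q = q * (dt p + e%:R * 'X * p - k%:P%:P * q) by exact: dvdp_mulIl.
  transitivity (q * dt p + e%:R * 'X * p * q - k%:P%:P * q ^+ 2); last by ring.
  by rewrite -E; ring.
case/Pdiv.WeakIdomain.dvdpP => -[s B] /= s0 sB.
pose d := (size q).-1; have sq : size q = d.+1 by rewrite /d prednK// lt0n size_poly_eq0.
have qd : q`_d != 0 by rewrite lead_coef_eq0.
have sL : (size (dt q + d%:R * 'X * q)%R <= size q)%N.
  by rewrite sq size_dt_weight// sq.
have sB' : s%:P * (dt q + d%:R * 'X * q) = (B + s%:P * (d%:R * 'X)) * q.
  by rewrite mulrDr mul_polyC sB; ring.
(* By degrees in t the cofactor lies in C[z], so q is semi-invariant up to [s] and has degree 0 in
   t. *)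
have /size1_polyC BE : (size (B + s%:P * (d%:R * 'X))%R <= 1)%N.
  have [->|B0] := eqVneq (B + s%:P * (d%:R * 'X)) 0; first by rewrite size_poly0.
  have : (size ((B + s%:P * (d%:R * 'X)) * q)%R <= size q)%N.
    by rewrite -sB' mul_polyC size_scale.
  rewrite size_mul// sq addnS /=.
  by rewrite -addn1 addnC leq_add2l.
have d0 : d = 0%N.
  by apply: (@semi_invariant_degree_frac d q _ s) => //; rewrite ?sq// sB' BE.
have qE : q = (q`_0)%:P by apply: size1_polyC; rewrite sq d0.
pose r := q`_0; rewrite -/r in qE.
have r0 : r != 0 by rewrite -polyC_eq0 -qE.
move: E; rewrite qE dtC => E.
have coefE j : r * ((dt p)`_j + (if j is i.+1 then e%:R * p`_i else 0)) - p`_j * r^`() =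
               if j is 0 then k%:P * r ^+ 2 else 0.
  have h := congr1 (fun u : {poly {poly C}} => u`_j) E.
  rewrite -[in X in _ = X]polyC_exp -[in X in _ = X]polyCM coefC in h.
  rewrite coefD coefB coefCM !coefMC -mulrA -polyC_natr coefCM coefXM in h.
  by case: j h => [|j] /= h; rewrite -[RHS]h; ring.
pose n := (size p).-1; have sp : size p = n.+1 by rewrite /n prednK// lt0n size_poly_eq0.
have pn : p`_n != 0 by rewrite lead_coef_eq0.
(* In degree n+1 only the two top terms remain, with total factor e - n. *)
have ne : n = e.
  have := coefE n.+1; rewrite coef_dt_top ?sp// [p`_n.+1]nth_default ?sp//.
  rewrite mul0r subr0 -mulNr -mulrDl => /eqP.
  rewrite !mulf_eq0 (negPf r0) (negPf pn) orbF /= addrC subr_eq0.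
  by rewrite -!polyC_natr => /eqP /polyC_inj /eqP; rewrite eqr_nat => /eqP.
(* For k = 0, p itself is semi-invariant up to the factor r, of degree e > 0. *)
have [k0|k0] := eqVneq k 0.
  suff /eqP : e = 0%N by rewrite -leqn0 leqNgt e0.
  apply: (@semi_invariant_degree_frac e p r^`() r) => //; first by rewrite sp ne.
  move: E; rewrite k0 !polyC0 mul0r => /eqP E; apply/eqP; rewrite -subr_eq0 -(eqP E).
  by apply/eqP; ring.
(* Now u p / q = (p_0 u + p_1 u') / r, so y = p_1 / r would solve y'' = z y - k. *)
have e1 : e = 1%N by case: ke => // /eqP; rewrite (negPf k0).
apply: (@airy_no_rational k p`_0 p`_1 r) => //.
- have := coefE 0%N; rewrite coef_dt /= => h; rewrite -[RHS]h; ring.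
- have := coefE 1%N; rewrite coef_dt [p`_2]nth_default ?sp ?ne ?e1//= => h; rewrite -[RHS]h; ring.
Qed.

(** Division by the gcd is exact only up to powers of its leading coefficient, so p and q are first
    scaled by the common factor [h]; the equation is homogeneous of degree 2 in the pair. *)
Lemma airy_ratio e (k : C) p q : (0 < e)%N -> p != 0 -> q != 0 ->
  k = 0 \/ e = 1%N ->
  q * dt p - p * dt q + e%:R * 'X * p * q = k%:P%:P * q ^+ 2 -> False.
Proof.
move=> e0 p0 q0 ke E; have cop := @coprimep_div_gcd _ p q.
have := dvdp_gcdl p q; have := dvdp_gcdr p q; set g := gcdp p q in cop *.
rewrite !Pdiv.WeakIdomain.dvdp_eq.
set c2 := lead_coef g ^+ _; set q1 := q %/ g => /eqP q1E.
set c1 := lead_coef g ^+ _; set p1 := p %/ g => /eqP p1E.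
have g0 : g != 0 by rewrite gcdp_eq0 negb_and p0.
have c10 : c1 != 0 by rewrite expf_neq0// lead_coef_eq0.
have c20 : c2 != 0 by rewrite expf_neq0// lead_coef_eq0.
have p10 : p1 != 0.
  apply: contraNneq p0 => p10; move/eqP: p1E; rewrite p10 mul0r.
  by rewrite -mul_polyC mulf_eq0 polyC_eq0 (negPf c10).
have q10 : q1 != 0.
  apply: contraNneq q0 => q10; move/eqP: q1E; rewrite q10 mul0r.
  by rewrite -mul_polyC mulf_eq0 polyC_eq0 (negPf c20).
pose h : {poly {poly C}} := (c1 * c2)%:P.
have hp : h * p = (c2 *: p1) * g.
  by rewrite -scalerAl -p1E scalerA (mulrC c2) -mul_polyC.
have hq : h * q = (c1 *: q1) * g by rewrite -scalerAl -q1E scalerA -mul_polyC.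
apply: (@airy_ratio_coprime e k (c2 *: p1) (c1 *: q1)) => //.
- by rewrite -mul_polyC mulf_eq0 polyC_eq0 negb_or c20.
- by rewrite -mul_polyC mulf_eq0 polyC_eq0 negb_or c10.
- by rewrite coprimepZl// coprimepZr// cop// p0.
apply: (mulfI (mulf_neq0 g0 g0)).
have gE u v : g * g * (v * dt u - u * dt v + e%:R * 'X * u * v) =
    (v * g) * dt (u * g) - (u * g) * dt (v * g) + e%:R * 'X * (u * g) * (v * g).
  by rewrite !dtM; ring.
rewrite gE -hp -hq !dtM.
transitivity (h ^+ 2 * (q * dt p - p * dt q + e%:R * 'X * p * q)); first by ring.
by rewrite E; transitivity (k%:P%:P * (h * q) ^+ 2); [|rewrite hq]; ring.
Qed.

End Forms.

(** * Differential ideals of C[z][t][l][w] *)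

Lemma extend_derE (A : comNzRingType) (d : A -> A) (g : {poly A}) (c : A) : d 0 = 0 ->
  extend_der d g c%:P = (d c)%:P.
Proof.
move=> d0; rewrite /extend_der derivC mulr0 addr0; apply/polyP => i.
by rewrite coef_map_id0// !coefC; case: ifP.
Qed.

Lemma coefM_top (A : nzRingType) (p q : {poly A}) m n :
  (size p <= m.+1)%N -> (size q <= n.+1)%N -> (p * q)`_(m + n) = p`_m * q`_n.
Proof.
move=> pm qn; have mn : (m < (m + n).+1)%N by rewrite ltnS leq_addr.
rewrite coefM (bigD1 (Ordinal mn))//= addKn big1 ?addr0// => -[j jmn] /= jm.
have [lt_jm|lt_mj|eq_jm] := ltngtP j m.
- rewrite [q`__]nth_default ?mulr0// (leq_trans qn)//; lia.
- by rewrite nth_default ?mul0r// (leq_trans pm).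
- by move/eqP: jm; case; apply/val_inj.
Qed.

Section AiryIdeals.
Variable C : numClosedFieldType.
Local Notation pz := {poly C}.
Local Notation pt := {poly {poly C}}.
Local Notation pl := {poly {poly {poly C}}}.
Local Notation pw := {poly {poly {poly {poly C}}}}.

Definition dl (p : pl) : pl := extend_der (@dt C) ('X *: 'X) p.
Definition dw (p : pw) : pw := extend_der dl ('X%:P) p.

Lemma dt0 : dt 0 = 0 :> pt.
Proof. by rewrite -[0 in LHS]polyC0 dtC deriv0. Qed.

Lemma coef_dl (p : pl) i : (dl p)`_i = dt p`_i + 'X * (p`_i *+ i).
Proof. exact/coef_extend_derX/dt0. Qed.

Lemma dlC (p : pt) : dl p%:P = (dt p)%:P.
Proof. exact/extend_derE/dt0. Qed.

Lemma dl0 : dl 0 = 0.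
Proof. by rewrite -[0 in LHS]polyC0 dlC dt0. Qed.

Lemma coef_dw (p : pw) i : (dw p)`_i = dl p`_i + 'X * (p`_i.+1 *+ i.+1).
Proof. exact/coef_extend_derC/dl0. Qed.

Lemma dwC (p : pl) : dw p%:P = (dl p)%:P.
Proof. exact/extend_derE/dl0. Qed.

(** Models the relations that hold where u != 0: saturation reflects that l is invertible there, and
    the last field makes the ideal proper. *)
Record airy_ideal (I : pw -> Prop) : Prop := AiryIdeal {
  airy_idealB : forall P Q, I P -> I Q -> I (P - Q);
  airy_idealM : forall P Q, I Q -> I (P * Q);
  airy_ideal_der : forall P, I P -> I (dw P);
  airy_ideal_sat : forall P, I ('X%:P * P) -> I P;
  airy_ideal_const : forall c : C, I c%:P%:P%:P%:P -> c = 0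
}.

Variable I : pw -> Prop.
Hypothesis airy_I : airy_ideal I.

Let memD P Q : I P -> I Q -> I (P + Q).
Proof.
move=> IP IQ; rewrite -[Q]opprK; apply: (airy_idealB airy_I) => //.
by rewrite -mulN1r; apply: (airy_idealM airy_I).
Qed.

Lemma airy_ideal_t (p : pt) : I p%:P%:P -> p = 0.
Proof.
have [n] := ubnP (size p); elim: n p => // n IHn p.
have [m] := ubnP (size (lead_coef p)); elim: m p => // m IHm p pm pn Ip.
apply/eqP/negPn/negP => p0.
pose d := (size p).-1; have sp : size p = d.+1 by rewrite /d prednK// lt0n size_poly_eq0.
have pd : p`_d != 0 by rewrite lead_coef_eq0.
have IM (q r : pt) : I r%:P%:P -> I (q * r)%:P%:P.
  by rewrite 2!polyCM; apply: (airy_idealM airy_I).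
have Idt (q : pt) : I q%:P%:P -> I (dt q)%:P%:P.
  by move/(airy_ideal_der airy_I); rewrite dwC dlC.
pose q := dt p + d%:R * 'X * p.
have sq : (size q <= d.+1)%N by apply: size_dt_weight; rewrite sp.
(* After division of leading coefficients, [r] has smaller degree than [p] or a leading coefficient
   of smaller degree, so it is 0 and [p] is semi-invariant. *)
pose r := q - (q`_d %/ p`_d)%:P * p.
have rd : r`_d = q`_d %% p`_d.
  by rewrite coefB coefCM {1}(divp_eq q`_d p`_d) [LHS]addrC addKr.
have sr : (size r <= d.+1)%N.
  apply: leq_trans (size_polyD _ _) _; rewrite geq_max sq size_polyN mul_polyC.
  by rewrite (leq_trans (size_scale_leq _ _))// sp.
have Ir : I r%:P%:P.
  rewrite 2!polyCB; apply: (airy_idealB airy_I); last exact: IM.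
  by rewrite 2!polyCD; apply: memD; [exact: Idt|exact: IM].
have r0 : r = 0.
  have [rd'|rd'] := leqP (size r) d.
    by apply: IHn => //; rewrite (leq_ltn_trans rd')// -ltnS -sp.
  have sr' : size r = d.+1 by apply/eqP; rewrite eqn_leq sr.
  apply: IHm => //; last by rewrite sr' -sp.
  rewrite /lead_coef sr' /= rd -ltnS (leq_trans _ pm)// ltnS.
  by rewrite /lead_coef ltn_modpN0.
have d0 : d = 0%N.
  apply: (@semi_invariant_degree C d p (q`_d %/ p`_d)) => //; first by rewrite sp.
  exact: subr0_eq r0.
have pE : p = (p`_0)%:P by apply: size1_polyC; rewrite sp d0.
(* Now [p] lies in C[z]; its derivative has smaller degree, so it vanishes and [p] is constant. *)
have : (p`_0)^`()%:P = 0 :> pt.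
  apply: IHm.
  - rewrite lead_coefC -ltnS (leq_trans _ pm)// /lead_coef -/d d0.
    by rewrite ltnS lt_size_deriv// -d0.
  - by rewrite (leq_ltn_trans _ pn)// sp d0 size_polyC_leq1.
  - by rewrite -dtC -pE; exact: Idt.
move/eqP; rewrite polyC_eq0 => /eqP p'0.
have p00 : p`_0 = (p`_0`_0)%:P.
  apply/polyP => -[|i]; rewrite coefC//=.
  have := congr1 (fun u : pz => u`_i) p'0.
  by rewrite coef_deriv coef0 => /eqP; rewrite mulrn_eq0 /= => /eqP.
have c0 : p`_0`_0 = 0.
  by apply: (airy_ideal_const airy_I); move: Ip; rewrite {1}pE {1}p00.
by move: pd; rewrite d0 p00 c0 polyC0 eqxx.
Qed.

Lemma airy_ideal_l (p : pl) : I p%:P -> p = 0.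
Proof.
have [n] := ubnP (size p); elim: n p => // n IHn p pn Ip.
apply/eqP/negPn/negP => p0.
pose d := (size p).-1; have sp : size p = d.+1 by rewrite /d prednK// lt0n size_poly_eq0.
have pd : p`_d != 0 by rewrite lead_coef_eq0.
have [d0|d0] := posnP d.
  have pE : p = (p`_0)%:P by apply: size1_polyC; rewrite sp d0.
  by move/eqP: pd; apply; rewrite d0; apply: airy_ideal_t; rewrite -pE.
(* Saturation allows division by l, so the constant term may be assumed nonzero. *)
have [p00|p00] := eqVneq p`_0 0.
  have pE : p = 'X * \poly_(i < d) p`_i.+1.
    apply/polyP => -[|i]; rewrite coefXM//= coef_poly; case: ltnP => // di.
    by rewrite nth_default ?sp.
  suff q0 : \poly_(i < d) p`_i.+1 = 0 by rewrite pE q0 mulr0 eqxx in p0.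
  apply: IHn; first by rewrite (leq_ltn_trans (size_poly _ _))// -sp -ltnS.
  by apply: (airy_ideal_sat airy_I); rewrite -polyCM -pE.
pose c := dt p`_d + 'X * (p`_d *+ d).
(* The top terms in l cancel. The constant term of q = 0 then says that l^d p_d / p_0 has derivative
   0. *)
pose q := (p`_d)%:P * dl p - c%:P * p.
have q0 : q = 0.
  apply: IHn.
    rewrite -ltnS (leq_ltn_trans _ pn)// sp ltnS; apply/leq_sizeP => j.
    rewrite coefB !coefCM coef_dl leq_eqVlt => /predU1P[<-|dj].
      by rewrite /c mulrC subrr.
    by rewrite [p`_j]nth_default ?sp// dt0 mul0rn !mulr0 addr0 mulr0 subrr.
  rewrite polyCB; apply: (airy_idealB airy_I); rewrite polyCM; apply: (airy_idealM airy_I) => //.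
  by rewrite -dwC; apply: (airy_ideal_der airy_I).
apply: (@airy_ratio C d 0 p`_d p`_0) => //; first by left.
have := congr1 (fun u : pl => u`_0) q0.
rewrite coefB !coefCM coef_dl mulr0n mulr0 addr0 coef0 /c -mulr_natl => /eqP.
rewrite -oppr_eq0 => /eqP h; rewrite !polyC0 mul0r -[RHS]h; ring.
Qed.

Lemma airy_ideal_eq0 (p : pw) : I p -> p = 0.
Proof.
have [n] := ubnP (size p); elim: n p => // n IHn p pn Ip.
apply/eqP/negPn/negP => p0.
pose d := (size p).-1; have sp : size p = d.+1 by rewrite /d prednK// lt0n size_poly_eq0.
have pd : p`_d != 0 by rewrite lead_coef_eq0.
have [d0|d0] := posnP d.
  have pE : p = (p`_0)%:P by apply: size1_polyC; rewrite sp d0.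
  by move/eqP: pd; apply; rewrite d0; apply: airy_ideal_l; rewrite -pE.
pose q := (p`_d)%:P * dw p - (dl p`_d)%:P * p.
have q0 : q = 0.
  apply: IHn.
    rewrite -ltnS (leq_ltn_trans _ pn)// sp ltnS; apply/leq_sizeP => j.
    rewrite coefB !coefCM coef_dw leq_eqVlt => /predU1P[<-|dj].
      by rewrite [p`_d.+1]nth_default ?sp// mul0rn mulr0 addr0 mulrC subrr.
    rewrite [p`_j]nth_default ?sp// [p`_j.+1]nth_default ?sp 1?ltnW//.
    by rewrite dl0 mul0rn !mulr0 addr0 mulr0 subrr.
  apply: (airy_idealB airy_I); apply: (airy_idealM airy_I) => //.
  exact: (airy_ideal_der airy_I).
(* With v = p_d and u = p_(d-1), this coefficient reads (u / v)' = - d l. *)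
have := congr1 (fun u : pw => u`_d.-1) q0.
rewrite coefB !coefCM coef_dw prednK// coef0.
set v := p`_d in pd *; set u := p`_d.-1 => E.
clear n IHn pn.
pose n := (size v).-1; have sv : size v = n.+1 by rewrite /n prednK// lt0n size_poly_eq0.
have vn : v`_n != 0 by rewrite lead_coef_eq0.
(* A bound for the degrees in l of u and of l v; the coefficient of l^(n+m) is compared next. *)
pose m := maxn (size u).-1 n.+1.
have nm : (n < m)%N by rewrite leq_maxr.
have su : (size u <= m.+1)%N by rewrite (leq_trans (leqSpred _))// ltnS leq_maxl.
have size_dl (w : pl) : (size (dl w) <= size w)%N.
  by apply/leq_sizeP => j wj; rewrite coef_dl nth_default// dt0 mul0rn mulr0 addr0.
have sX : (size ('X * (v *+ d))%R <= m.+1)%N.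
  apply/leq_sizeP => -[//|j] mj; rewrite coefXM coefMn /= nth_default ?mul0rn//.
  by rewrite sv (leq_trans nm).
have {}E : v`_n * ((dl u)`_m + v`_m.-1 * d%:R) - (dl v)`_n * u`_m = 0.
  have := congr1 (fun w : pl => w`_(n + m)) E.
  rewrite coef0 coefB !coefM_top ?sv ?(leq_trans (size_dl _)) ?sv//; last first.
    by rewrite (leq_trans (size_polyD _ _))// geq_max sX (leq_trans (size_dl _)).
  by rewrite coefD coefXM coefMn mulr_natr gtn_eqF// (leq_ltn_trans _ nm).
have du : (dl u)`_m = dt u`_m + m%:R * 'X * u`_m.
  by rewrite coef_dl -mulr_natl; ring.
have dv : (dl v)`_n = dt v`_n + n%:R * 'X * v`_n.
  by rewrite coef_dl -mulr_natl; ring.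
have v_pred : v`_m.-1 = if m == n.+1 then v`_n else 0.
  case: eqP => [->//|/eqP mn].
  have n1m : (n.+1 < m)%N by rewrite ltn_neqAle nm andbT eq_sym.
  by rewrite nth_default// sv -ltnS (ltn_predK n1m).
have dn0 : d%:R != 0 :> pt by rewrite -!polyC_natr !polyC_eq0 pnatr_eq0 -lt0n.
(* If u_m = 0, then m = n+1 and the equation reduces to d v_n^2 = 0. *)
have [um|um] := eqVneq u`_m 0.
  have mn : m = n.+1.
    apply/eqP; rewrite eqn_leq nm andbT leqNgt; apply/negP => nm'.
    have mu : m = (size u).-1.
      by apply/eqP; move: nm'; rewrite /m /maxn; case: ifP => //; rewrite ltnn.
    move: um; rewrite mu => /eqP; rewrite lead_coef_eq0 -size_poly_eq0 => /eqP su0.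
    by move: nm; rewrite mu su0.
  move/eqP: E; rewrite du um v_pred mn eqxx dt0 !mulr0 subr0 !add0r.
  by rewrite !mulf_eq0 (negPf vn) (negPf dn0).
(* For f = l^(m-n) u_m / v_n the equation says f' = k l; the term - d l has the right degree only if
   m = n+1. *)
pose k : C := if m == n.+1 then - d%:R else 0.
apply: (@airy_ratio C (m - n) k u`_m v`_n) => //.
- by rewrite subn_gt0.
- by rewrite /k; case: eqP => [->|_]; [right; rewrite subSnn|left].
- have kE : k%:P%:P * v`_n = - (v`_m.-1 * d%:R).
    rewrite v_pred /k; case: eqP => _; last by rewrite !polyC0 !mul0r oppr0.
    by rewrite !polyCN !polyC_natr; ring.
  rewrite expr2 mulrA kE natrB ?(ltnW nm)//.
  move: E; rewrite du dv => E.
  by apply: subr0_eq; rewrite -[RHS]E; ring.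
Qed.

End AiryIdeals.

Local Open Scope classical_set_scope.

(** * Derivatives of evaluated polynomials *)

Section EvaluationDerivative.
Variable K : numFieldType.
Implicit Types (f g : K^o -> K^o) (z : K^o).

(** The evaluation [e] of the coefficients moves with the point, so that the chain rule can be
    applied in turn to w, l and t. *)
Lemma is_derive_horner_map (A : comNzRingType) (e : K^o -> {rmorphism A -> K})
    (d : A -> A) (g : {poly A}) f z : d 0 = 0 ->
  (forall a, is_derive z 1 (fun x => e x a : K^o) (e z (d a))) ->
  is_derive z 1 f (map_poly (e z) g).[f z] ->
  forall p, is_derive z 1 (fun x => (map_poly (e x) p).[f x] : K^o)
                          (map_poly (e z) (extend_der d g p)).[f z].
Proof.
move=> d0 ed fd; elim/poly_ind => [|p c IH].
  have -> : (fun x => (map_poly (e x) 0).[f x] : K^o) = cst 0.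
    by apply/funext => x; rewrite rmorph0 horner0.
  rewrite /extend_der deriv0 mulr0 addr0 map_poly0 rmorph0 horner0.
  exact: is_derive_cst.
have -> : extend_der d g (p * 'X + c%:P) = extend_der d g p * 'X + g * p + (d c)%:P.
  rewrite /extend_der derivMXaddC.
  have -> : map_poly d (p * 'X + c%:P) = map_poly d p * 'X + (d c)%:P.
    apply/polyP => i; rewrite coef_map_id0// !coefD !coefMX !coefC.
    case: i => [|i] /=; first by rewrite !add0r.
    by rewrite !addr0 coef_map_id0.
  by ring.
have -> : (fun x => (map_poly (e x) (p * 'X + c%:P)).[f x] : K^o) =
    (fun x => (map_poly (e x) p).[f x] : K^o) * f + (fun x => e x c : K^o).
  by apply/funext => x; rewrite rmorphD rmorphM /= map_polyX map_polyC !hornerE.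
apply: is_derive_eq.
move: (extend_der d g p) => dp.
rewrite !rmorphD !rmorphM /= map_polyX map_polyC !hornerE /=.
by rewrite /GRing.scale /=; ring.
Qed.

Lemma is_derive_polynomial (p : {poly K}) z :
  is_derive z 1 (fun x => p.[x] : K^o) p^`().[z].
Proof.
elim/poly_ind: p => [|p c IH].
  have -> : (fun x => (0 : {poly K}).[x] : K^o) = cst 0.
    by apply/funext => x; rewrite horner0.
  by rewrite deriv0 horner0; exact: is_derive_cst.
have -> : (fun x => (p * 'X + c%:P).[x] : K^o) =
    (fun x => p.[x] : K^o) * id + cst c.
  by apply/funext => x; rewrite !hornerE.
apply: is_derive_eq.
by rewrite derivMXaddC !hornerE /GRing.scale /=; ring.
Qed.

End EvaluationDerivative.

(** * The vanishing ideal of an Airy solution *)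

Section AiryEvaluation.
Variables (K : numClosedFieldType) (u v U : K^o -> K^o).
Hypotheses (du : forall z : K^o, is_derive z 1 u (v z))
           (dv : forall z : K^o, is_derive z 1 v (z * u z))
           (dU : forall z : K^o, is_derive z 1 U (u z)).

Definition eval_z (z : K^o) : {rmorphism {poly K} -> K} := horner_eval (z : K).
(** At a zero of [u] the value of t is the default 0; relations are therefore tested only where [u]
    is nonzero. *)
Definition eval_t (z : K^o) : {rmorphism {poly {poly K}} -> K} :=
  horner_eval (v z / u z : K) \o map_poly (eval_z z).
Definition eval_l (z : K^o) : {rmorphism {poly {poly {poly K}}} -> K} :=
  horner_eval (u z : K) \o map_poly (eval_t z).
Definition eval_w (z : K^o) : {rmorphism {poly {poly {poly {poly K}}}} -> K} :=
  horner_eval (U z : K) \o map_poly (eval_l z).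

Lemma eval_tE z p : eval_t z p = (map_poly (eval_z z) p).[v z / u z].
Proof. by []. Qed.

Lemma eval_lE z p : eval_l z p = (map_poly (eval_t z) p).[u z].
Proof. by []. Qed.

Lemma eval_wE z p : eval_w z p = (map_poly (eval_l z) p).[U z].
Proof. by []. Qed.

Lemma eval_tC z p : eval_t z p%:P = p.[z].
Proof. by rewrite eval_tE map_polyC hornerC. Qed.

Lemma eval_lC z p : eval_l z p%:P = eval_t z p.
Proof. by rewrite eval_lE map_polyC hornerC. Qed.

Lemma eval_wC z p : eval_w z p%:P = eval_l z p.
Proof. by rewrite eval_wE map_polyC hornerC. Qed.

Lemma eval_tX (z : K^o) : eval_t z 'X = v z / u z.
Proof. by rewrite eval_tE map_polyX hornerX. Qed.

Lemma eval_lX (z : K^o) : eval_l z 'X = u z.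
Proof. by rewrite eval_lE map_polyX hornerX. Qed.

Lemma is_derive_eval_w (z : K^o) P : u z != 0 ->
  is_derive z 1 (fun x => eval_w x P : K^o) (eval_w z (dw P)).
Proof.
move=> uz.
apply: is_derive_horner_map; [exact: dl0| |]; last first.
  by apply: is_derive_eq; rewrite map_polyC hornerC; exact/esym/eval_lX.
move=> {}P; apply: is_derive_horner_map; [exact: dt0| |]; last first.
  apply: is_derive_eq; rewrite -mul_polyC rmorphM /= map_polyC map_polyX !hornerE.
  transitivity (v z / u z * u z); first by rewrite divfK.
  by congr (_ * _); exact/esym/eval_tX.
move=> {}P; apply: is_derive_horner_map; [exact: deriv0| |]; last first.
  have du_inv : is_derive z 1 (fun x => (u x)^-1 : K^o) (- u z ^- 2 *: v z).
    by apply: DeriveDef; [exact: derivableV|rewrite deriveV// derive_val].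
  have -> : (fun x => v x / u x : K^o) = v * (fun x => (u x)^-1 : K^o) by [].
  apply: is_derive_eq.
  rewrite rmorphB rmorphXn /= map_polyC map_polyX !hornerE /= /horner_eval hornerX.
  by rewrite /GRing.scale /=; field.
move=> {}P; exact: is_derive_polynomial.
Qed.

Definition airy_vanishing (P : {poly {poly {poly {poly K}}}}) : Prop :=
  forall z, u z != 0 -> eval_w z P = 0.

Lemma airy_ideal_vanishing z0 : u z0 != 0 -> airy_ideal airy_vanishing.
Proof.
move=> uz0; split.
- by move=> P Q IP IQ z uz; rewrite rmorphB IP// IQ// subr0.
- by move=> P Q IQ z uz; rewrite rmorphM IQ// mulr0.
- move=> P IP z uz.
  (* By continuity [u] is nonzero near [z], so the evaluation of [P] is locally 0 and so is its
     derivative. *)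
  have [_ <-] := is_derive_eval_w P uz.
  rewrite (@near_eq_derive _ _ _ _ (cst 0 : K^o -> K^o) z 1); first exact: derive_cst.
  have /differentiable_continuous cu : differentiable u z by apply/derivable1_diffP.
  have : \forall x \near z, u x != 0 by exact: (cvgr_neq0 (u z) cu uz).
  by apply: filterS => x ux; rewrite IP.
- move=> P IP z uz; have /eqP := IP z uz.
  rewrite rmorphM mulf_eq0 => /orP[|/eqP//].
  by rewrite eval_wC eval_lX (negPf uz).
- move=> c /(_ z0 uz0).
  by rewrite eval_wC eval_lC eval_tC hornerC.
Qed.

End AiryEvaluation.

(** * Common denominators *)

Section CommonDenominator.
Variable D : idomainType.
Local Notation "x %:F" := (@FracField.tofrac D x).

Lemma fractionP (x : {fraction D}) : exists a b, b != 0 /\ x * b%:F = a%:F.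
Proof.
elim/quotW: x => r; exists (frac r).1, (frac r).2; split; first exact: denom_ratioP.
unlock FracField.tofrac; rewrite -[LHS]FracField.pi_mul; apply/eqmodP => /=.
rewrite FracField.equivfE /FracField.mulf.
by rewrite !numden_Ratio ?(mulr1, mul1r, oner_eq0, denom_ratioP)// mulrC.
Qed.

Lemma common_denominator (T : choiceType) (s : seq T) (r : T -> {fraction D}) :
  exists2 c : D, c != 0 & exists N : T -> D, forall m, m \in s -> r m * c%:F = (N m)%:F.
Proof.
suff [c c0 sc] : exists2 c : D, c != 0 & forall m, m \in s -> exists n, r m * c%:F = n%:F.
  exists c => //; have /choice[N NP] : forall m, exists n, m \in s -> r m * c%:F = n%:F.
    by move=> m; have [/sc[n]|_] := boolP (m \in s); [exists n|exists 0].
  by exists N.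
elim: s => [|x s [c c0 sc]]; first by exists 1 => //; exact: oner_neq0.
have [a [b [b0 xb]]] := fractionP (r x).
exists (b * c); first exact: mulf_neq0.
move=> m; rewrite inE => /predU1P[->|/sc[n mc]].
  by exists (a * c); rewrite !tofracM mulrA xb.
by exists (n * b); rewrite !tofracM mulrCA mc mulrC.
Qed.

End CommonDenominator.

(** * Monomials in the new coordinates *)

Section Monomials.
Variable K : numClosedFieldType.

(* The monomial [c u^i u'^j U^k], written with [u' = t l]. *)
Definition airy_monomial (c : {poly K}) (i j k : nat) : {poly {poly {poly {poly K}}}} :=
  ((c%:P * 'X^j)%:P * 'X^(i + j))%:P * 'X^k.

(** Distinct exponents occupy distinct places, so a sum of such monomials determines its
    coefficients. *)
Lemma coef_airy_monomial c i j k i' j' k' :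
  (airy_monomial c i j k)`_k'`_(i' + j')`_j' =
  if [&& i' == i, j' == j & k' == k] then c else 0.
Proof.
rewrite /airy_monomial !coefCM !coefXn.
have [_|_] := eqVneq k' k; last by rewrite mulr0 !coef0 !andbF.
rewrite mulr1 coefCM coefXn andbT.
have [e|ne] := eqVneq (i' + j')%N (i + j)%N; last first.
  rewrite mulr0 coef0 ifF//; apply/negP => /andP[/eqP ei /eqP ej].
  by move: ne; rewrite ei ej eqxx.
rewrite mulr1 coefCM coefXn; have [ej|_] := eqVneq j' j; last by rewrite mulr0 andbF.
by move: e; rewrite ej => /addIn ->; rewrite eqxx mulr1.
Qed.

End Monomials.

(** * Vanishing off a discrete set, and differentiability *)

Section Density.
Variable R : realType.

(** Each point z has a punctured neighbourhood free of [D], where f = 0; were f z nonzero,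
    continuity would make f nonzero near z. *)
Lemma continuous_mero_eq0 (f : R[i]^o -> R[i]^o) :
  continuous f -> mero_eq f (fun=> 0) -> forall z, f z = 0.
Proof.
move=> cf [D lD fD] z; apply/eqP/negPn/negP => fz.
have : ~ limit_point D z by rewrite lD.
move=> /existsNP[V /not_implyP[zV /forallNP VD]].
have nzf : \forall y \near z, f y != 0 by exact: (cvgr_neq0 (f z) (cf z) fz).
have /filter_ex[y []//] : \forall y \near z^', False.
apply: filterS2 (nbhs_dnbhs nzf) (_ : \forall y \near z^', f y = 0) => [y /eqP//|].
apply: filterS zV => y Vy yz; apply: fD => Dy.
by apply: (VD y); split.
Qed.

End Density.

Lemma derivable_mul (K : numFieldType) (f g : K^o -> K^o) (z : K^o) :
  derivable f z 1 -> derivable g z 1 -> derivable (fun x => f x * g x : K^o) z 1.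
Proof. exact: derivableM. Qed.

Lemma derivable_big_sum (K : numFieldType) (I : Type) (s : seq I)
    (F : I -> K^o -> K^o) (z : K^o) :
  (forall i, derivable (F i) z 1) -> derivable (fun x => \sum_(i <- s) F i x : K^o) z 1.
Proof.
move=> dF; elim: s => [|i s IH].
  have -> : (fun x => \sum_(i <- [::]) F i x : K^o) = cst 0.
    by apply/funext => x; rewrite big_nil.
  exact: derivable_cst.
have -> : (fun x => \sum_(i <- i :: s) F i x : K^o) =
          F i + (fun x => \sum_(i <- s) F i x : K^o).
  by apply/funext => x; rewrite big_cons.
exact: derivableD.
Qed.

Lemma derivable_exp (K : numFieldType) (f : K^o -> K^o) n (z : K^o) :
  derivable f z 1 -> derivable (fun x => f x ^+ n : K^o) z 1.
Proof.
move=> df; have -> : (fun x => f x ^+ n : K^o) = f ^+ n by rewrite exprfctE.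
exact: derivableX.
Qed.

(** * Algebraic independence *)

Theorem theorem1 (R : realType) (u U : R[i]^o -> R[i]^o)
    (airy_u : airy_solution u) (u_neq0 : u <> cst 0)
    (U_prim : antiderivative u U) :
  alg_independent [tuple u; u^`(); U].
Proof.
case: airy_u => der_u der_u' airy_eq P P0.
have [z0 uz0] : exists z0, u z0 != 0.
  apply: contrapT => /forallNP u0; apply: u_neq0; apply/funext => z.
  by apply/eqP/negPn/negP/u0.
pose v := u^`().
have du z : is_derive (z : R[i]^o) 1 u (v z).
  by rewrite /v derive1E; exact/derivableP.
have dv z : is_derive (z : R[i]^o) 1 v (z * u z).
  by rewrite -airy_eq /derive1n /= derive1E; exact/derivableP.
have [c c0 [N NP]] := common_denominator (msupp P) (fun m => mcoeff m P).
pose i0 : 'I_3 := ord0; pose i1 : 'I_3 := lift ord0 ord0.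
pose i2 : 'I_3 := lift ord0 (lift ord0 ord0).
pose w z (m : mpoly.multinom 3) := u z ^+ m i0 * v z ^+ m i1 * U z ^+ m i2.
(* Multiplying the relation by c^2 rather than c keeps a factor c in each term, so the sum also
   vanishes at the zeros of c, where [ratfun_eval] need not agree with the quotient of values. *)
have Nw z : \sum_(m <- msupp P) (c * N m).[z] * w z m = 0.
  apply: (@continuous_mero_eq0 R (fun z => \sum_(m <- msupp P) (c * N m).[z] * w z m)).
    move=> {}z; apply/differentiable_continuous/derivable1_diffP.
    apply: derivable_big_sum => m; apply: derivable_mul.
      by have [] := is_derive_polynomial (c * N m) z.
    apply: derivable_mul; last by apply: derivable_exp; have [] := U_prim z.
    by apply: derivable_mul; exact: derivable_exp.
  case: P0 => E lE EP; exists E => // {}z Ez.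
  have [cz|cz] := eqVneq c.[z] 0.
    by rewrite big1// => m _; rewrite hornerM cz !mul0r.
  transitivity (c.[z] ^+ 2 * 0); last by rewrite mulr0.
  rewrite -[X in _ * X](EP z Ez) mulr_sumr; apply: eq_big_seq => m mP.
  have -> : mcoeff m P = FracField.tofrac (N m) / FracField.tofrac c.
    by rewrite -NP// mulfK// tofrac_eq0.
  rewrite ratfun_evalE// /mpoly.mmap1 !big_ord_recl big_ord0 mulr1.
  have key (x y a b d : R[i]) : y != 0 ->
    y * x * (a * b * d) = y ^+ 2 * (x / y * (a * (b * d))) by move=> y0; field.
  by rewrite hornerM; exact: key.
(* The relation rewritten with u' = t l; it vanishes where u != 0, so it lies in the ideal. *)
pose Q := \sum_(m <- msupp P) airy_monomial (c * N m) (m i0) (m i1) (m i2).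
have Q0 : Q = 0.
  apply: (airy_ideal_eq0 (airy_ideal_vanishing du dv U_prim uz0)) => z uz.
  rewrite rmorph_sum -[RHS](Nw z); apply: eq_bigr => m _.
  rewrite /airy_monomial rmorphM rmorphXn eval_wC rmorphM rmorphXn eval_lC.
  rewrite rmorphM rmorphXn eval_tC eval_tX eval_lX eval_wE map_polyX hornerX.
  rewrite /w expr_div_n exprD.
  have key (x a b d y : R[i]) : a != 0 -> x * (b / a) * (d * a) * y = x * (d * b * y).
    by move=> a0; field.
  by apply: key; exact: expf_neq0.
apply: msuppnil0; case E : (msupp P) => [//|m s].
have mP : m \in msupp P by rewrite E inE eqxx.
suff cN0 : c * N m = 0.
  move: mP; rewrite mcoeff_msupp => /eqP[].
  have := NP m; rewrite E inE eqxx => /(_ isT).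
  move/eqP: cN0; rewrite mulf_eq0 (negPf c0) /= => /eqP ->.
  by rewrite tofrac0 => /eqP; rewrite mulf_eq0 tofrac_eq0 (negPf c0) orbF => /eqP.
(* The coefficient at the exponents of [m] isolates [c * N m]. *)
have := congr1 (fun q : {poly {poly {poly {poly R[i]}}}} =>
  q`_(m i2)`_(m i0 + m i1)`_(m i1)) Q0.
rewrite !coef0 /Q !coef_sum => <-.
rewrite (bigD1_seq m) ?msupp_uniq//= coef_airy_monomial !eqxx big1 ?addr0// => m' m'm.
rewrite coef_airy_monomial ifF//; apply/negP => /and3P[/eqP e0 /eqP e1 /eqP e2].
move/eqP: m'm; apply; apply/mnmP => i.
case: (unliftP ord0 i) => [j|] -> //; case: (unliftP ord0 j) => [k|] -> //.
by rewrite (ord1 k).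
Qed.
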